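(* Let $n\neq-2,-1,0$ be real, $\mu=\frac{3n+4}{n+2}$, $\lambda_1=\frac{n^2}{4(n+1)^2}$ and $\lambda_2=-\frac{n}{2(n+1)^2}$. The point transformation $$x'=v^{\frac{n}{2n+2}},\qquad t'=t,\qquad u'=x^{-\frac{2}{n+2}}v^{\frac{1}{n+1}}u^{-1},\qquad v'=\frac{n(n+2)}{4(n+1)^2}x^{\frac{2n+2}{n+2}}$$ transforms the system $$v'_{x'}=x'u',\qquad v'_{t'}=\lambda_1x'{u'}^{-(n+2)}u'_{x'}+\lambda_2{u'}^{-(n+1)}$$ to the system $$v_x=ux,\qquad v_t=xu^nu_x+\frac{\mu-1}{n+1}u^{n+1}.$$ Moreover, the point transformation $x'=v^{\frac{n}{2n+2}}$, $t'=t$, $v'=\frac{n(n+2)}{4(n+1)^2}x^{\frac{2n+2}{n+2}}$ maps the equation $$v'_{t'}=\lambda_1\left(\frac{v'_{x'}}{x'}\right)^{-(n+2)}v'_{x'x'}+(\lambda_2-\lambda_1)\left(\frac{v'_{x'}}{x'}\right)^{-(n+1)}$$ into the equation $$v_t=\left(\frac{v_x}{x}\right)^nv_{xx}-\frac{n}{n+2}\left(\frac{v_x}{x}\right)^{n+1}.$$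
   Context: Subscripts denote partial derivatives. A point transformation $x'=P(x,t,v)$, $t'=t$, $u'=R(x,t,u,v)$, $v'=S(x,t,v)$ ''transforms (maps) a system $E'$ for $(u',v')(x',t')$ to (into) a system $E$ for $(u,v)(x,t)$'' if: whenever $(u,v)$ are smooth positive functions on an open set $D\subset\{x>0\}$ such that $(x,t)\mapsto(P(x,t,v(x,t)),t)$ is a diffeomorphism of $D$ onto an open set $D'$, and $(u',v')$ are the functions on $D'$ whose values at $(P(x,t,v(x,t)),t)$ are $R(x,t,u(x,t),v(x,t))$ and $S(x,t,v(x,t))$, then $(u',v')$ satisfies $E'$ on $D'$ if and only if $(u,v)$ satisfies $E$ on $D$. For the scalar equations the same definition is used without $u,u'$, for $v>0$ with $v_x>0$ on $D\subset\{x>0\}$. *)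

(* Defs.v *)
From Stdlib Require Import Reals.
From Coquelicot Require Import Coquelicot.

Open Scope R_scope.

Definition partial_x (f : R -> R -> R) (x t : R) : R := Derive (fun z => f z t) x.
Definition partial_t (f : R -> R -> R) (x t : R) : R := Derive (fun z => f x z) t.

(* On an open set D this is C^infinity: [ex_diff_n f k x t] asks for existence
   and continuity at (x, t) of all iterated partial derivatives of order <= k.
   [f] is total, but only its values on D matter. *)
Definition smooth_on (D : R * R -> Prop) (f : R -> R -> R) : Prop :=
  forall (k : nat) (x t : R), D (x, t) -> ex_diff_n f k x t.

Definition smooth_map_on (D : R * R -> Prop) (phi : R * R -> R * R) : Prop :=
  smooth_on D (fun x t => fst (phi (x, t))) /\
  smooth_on D (fun x t => snd (phi (x, t))).

Definition diffeomorphism (D D' : R * R -> Prop) (phi : R * R -> R * R) : Prop :=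
  smooth_map_on D phi /\
  (forall p, D p -> D' (phi p)) /\
  exists psi : R * R -> R * R,
    smooth_map_on D' psi /\
    (forall q, D' q -> D (psi q)) /\
    (forall p, D p -> psi (phi p) = p) /\
    (forall q, D' q -> phi (psi q) = q).

(* Systems for (u, v)(x, t) and equations for v(x, t), evaluated at a point. *)
Definition pde_system := (R -> R -> R) -> (R -> R -> R) -> R -> R -> Prop.
Definition pde := (R -> R -> R) -> R -> R -> Prop.

(* The point transformation x' = P(x,t,v), t' = t, u' = Q(x,t,u,v),
   v' = S(x,t,v) maps the system E' to the system E.  As u' and v' are total
   functions, "the functions on D'" are any extensions of the prescribed
   values; since D' is open, E' on D' does not depend on the extension. *)
Definition transforms_system
    (P : R -> R -> R -> R) (Q : R -> R -> R -> R -> R) (S : R -> R -> R -> R)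
    (E' E : pde_system) : Prop :=
  forall (D D' : R * R -> Prop) (u v u' v' : R -> R -> R),
    open D -> open D' ->
    (forall x t, D (x, t) -> 0 < x) ->
    smooth_on D u -> smooth_on D v ->
    (forall x t, D (x, t) -> 0 < u x t /\ 0 < v x t) ->
    diffeomorphism D D'
      (fun p => (P (fst p) (snd p) (v (fst p) (snd p)), snd p)) ->
    (forall x t, D (x, t) ->
       u' (P x t (v x t)) t = Q x t (u x t) (v x t) /\
       v' (P x t (v x t)) t = S x t (v x t)) ->
    ((forall x' t', D' (x', t') -> E' u' v' x' t') <->
     (forall x t, D (x, t) -> E u v x t)).

Definition transforms_equation
    (P S : R -> R -> R -> R) (E' E : pde) : Prop :=
  forall (D D' : R * R -> Prop) (v v' : R -> R -> R),
    open D -> open D' ->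
    (forall x t, D (x, t) -> 0 < x) ->
    smooth_on D v ->
    (forall x t, D (x, t) -> 0 < v x t /\ 0 < partial_x v x t) ->
    diffeomorphism D D'
      (fun p => (P (fst p) (snd p) (v (fst p) (snd p)), snd p)) ->
    (forall x t, D (x, t) -> v' (P x t (v x t)) t = S x t (v x t)) ->
    ((forall x' t', D' (x', t') -> E' v' x' t') <->
     (forall x t, D (x, t) -> E v x t)).

(* Main.v *)
Require Import Defs.
From Stdlib Require Import Reals Lra.
From Coquelicot Require Import Coquelicot.
Open Scope R_scope.

(** Put [X = v ^ (n / (2n+2))], so that the transformation sends [(x, t)] to
    [(X(x, t), t)] and [v'] is, up to a constant and a power, the old variable
    [x]: it is a hodograph-type exchange of [x] and a power of [v].

    A diffeomorphism of the form [(x, t) |-> (X(x, t), t)] has [X_x <> 0], and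
    the first component [g] of its inverse satisfies [g_x' = 1 / X_x] and
    [g_t' = - X_t / X_x] ([fibred_jacobian_neq0],
    [fibred_inverse_derivatives]).  A function on the image given by its values at
    [(X(x, t), t)] can thus be differentiated in the old coordinates.  With
    [b = (2n+2) / (n+2)] this gives

      [v'_x' = x^b v / (x X v_x)],
      [v'_t' = - n / (2n+2) * x^(b-1) * v_t / v_x],

    and [u'_x'] from the logarithmic derivative of [u'].

    The two equations of the system then correspond to each other separately,
    at each pair of matching points.  Since
    [x' u' = x^b v / (x^2 X u)], the equation [v'_x' = x' u'] says
    [v_x = x u] ([gradient_equation_iff]).  In the second equation
    [u'^(-(n+1)) = x^b u^(n+1) / v]; the coefficients [lambda1] and [lambda2]
    are exactly those for which the contribution of [v_x] to [u'_x'] cancels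
    the [lambda2] term, and what is left is the second equation for [(u, v)]
    multiplied by a nonzero factor ([flow_equation_iff]).  Here
    [u] is any positive differentiable function of [x].

    For the scalar equations take [u = v_x / x] and [u' = v'_x' / x'].  Then
    the first equations hold by definition, so [u'] is the transform of [u],
    and [v_xx = x u_x + u] together with its primed analogue turns each scalar
    equation into the second equation of the corresponding system. *)

(** * Smooth functions on an open set of the plane *)

Lemma open_slice_x (D : R * R -> Prop) (x t : R) :
  open D -> D (x, t) -> locally x (fun z => D (z, t)).
Proof.
  intros HD Hp. apply (locally_2d_1d_const_y (fun z s => D (z, s))).
  apply locally_2d_locally. generalize (HD _ Hp).
  apply filter_imp. intros [z s]; exact (fun H => H).
Qed.

Lemma open_slice_t (D : R * R -> Prop) (x t : R) :
  open D -> D (x, t) -> locally t (fun s => D (x, s)).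
Proof.
  intros HD Hp. apply (locally_2d_1d_const_x (fun z s => D (z, s))).
  apply locally_2d_locally. generalize (HD _ Hp).
  apply filter_imp. intros [z s]; exact (fun H => H).
Qed.

Lemma smooth_on_is_derive_x D f x t :
  smooth_on D f -> D (x, t) ->
  is_derive (fun z => f z t) x (partial_x f x t).
Proof.
  intros Hf Hp. apply Derive_correct. apply (Hf 1%nat x t Hp).
Qed.

Lemma smooth_on_is_derive_t D f x t :
  smooth_on D f -> D (x, t) ->
  is_derive (fun s => f x s) t (partial_t f x t).
Proof.
  intros Hf Hp. apply Derive_correct. apply (Hf 1%nat x t Hp).
Qed.

Lemma smooth_on_partial_x D f :
  smooth_on D f -> smooth_on D (partial_x f).
Proof.
  intros Hf k x t Hp. apply (Hf (S k) x t Hp).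
Qed.

(** Smoothness is phrased by iterated partial derivatives, whereas the chain
    rule in two variables needs total differentiability: a continuous first
    partial derivative in a neighbourhood provides it. *)
Lemma smooth_on_differentiable D f x t :
  open D -> smooth_on D f -> D (x, t) ->
  differentiable_pt_lim f x t (partial_x f x t) (partial_t f x t).
Proof.
  intros HD Hf Hp. apply filterdiff_differentiable_pt_lim.
  apply (is_derive_filterdiff f x t (partial_x f) (partial_t f x t)).
  - generalize (HD _ Hp). apply filter_imp. intros [z s] Hz.
    exact (smooth_on_is_derive_x D f z s Hf Hz).
  - exact (smooth_on_is_derive_t D f x t Hf Hp).
  - apply continuity_2d_pt_filterlim.
    exact (proj1 (smooth_on_partial_x D f Hf 0%nat x t Hp)).
Qed.

(** * Diffeomorphisms preserving the time variable *)

(** The inverse also preserves [t], so it is determined by one function [g];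
    the last two clauses say that [g] and [X] are inverse to each other on each
    line [t = const]. *)
Lemma inverse_of_fibred_diffeomorphism D D' (X : R -> R -> R) :
  diffeomorphism D D' (fun p => (X (fst p) (snd p), snd p)) ->
  exists g : R -> R -> R,
    smooth_on D X /\ smooth_on D' g /\
    (forall x t, D (x, t) -> D' (X x t, t) /\ g (X x t) t = x) /\
    (forall y t, D' (y, t) -> D (g y t, t) /\ X (g y t) t = y).
Proof.
  intros [[HX _] [Hmap [psi [[Hpsi _] [Hmap' [Hl Hr]]]]]].
  exists (fun y t => fst (psi (y, t))).
  split; [exact HX | split; [exact Hpsi | split]].
  - intros x t Hp. split; [exact (Hmap _ Hp) |].
    generalize (Hl _ Hp). simpl. intros ->. reflexivity.
  - intros y t Hq. generalize (Hr _ Hq) (Hmap' _ Hq).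
    destruct (psi (y, t)) as [z s]. simpl. intros E HD.
    injection E as E1 E2. subst s. now split.
Qed.

Section Fibred_change_of_variable.

Variables (D D' : R * R -> Prop) (X : R -> R -> R).
Hypothesis (openD : open D) (openD' : open D').
Hypothesis Hphi : diffeomorphism D D' (fun p => (X (fst p) (snd p), snd p)).

(** Differentiate [g (X x t) t = x] in [x]: the product of [X_x] with another
    number is 1. *)
Lemma fibred_jacobian_neq0 x t : D (x, t) -> partial_x X x t <> 0.
Proof.
  intros Hp. destruct (inverse_of_fibred_diffeomorphism _ _ _ Hphi)
    as [g [HX [Hg [Hgl Hgr]]]].
  destruct (Hgl x t Hp) as [Hq Hgx].
  assert (Hd : is_derive (fun z => g (X z t) t) x
                 (partial_x X x t * partial_x g (X x t) t)).
  { apply (is_derive_comp (fun y => g y t) (fun z => X z t)).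
    - exact (smooth_on_is_derive_x _ _ _ _ Hg Hq).
    - exact (smooth_on_is_derive_x _ _ _ _ HX Hp). }
  assert (H1 : is_derive (fun z => g (X z t) t) x 1).
  { apply (is_derive_ext_loc (fun z => z)).
    - generalize (open_slice_x _ _ _ openD Hp). apply filter_imp.
      intros z Hz. symmetry. apply (Hgl z t Hz).
    - apply (is_derive_id (K := R_AbsRing)). }
  intros H0. apply is_derive_unique in Hd. apply is_derive_unique in H1.
  rewrite Hd, H0 in H1. lra.
Qed.

(** Implicit differentiation of [X (g y t) t = y] in [y] and in [t].  Only the
    second needs the two-variable chain rule, because [t] occurs twice. *)
Lemma fibred_inverse_derivatives g x t :
  smooth_on D' g ->
  (forall y s, D' (y, s) -> D (g y s, s) /\ X (g y s) s = y) ->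
  D (x, t) -> D' (X x t, t) -> g (X x t) t = x ->
  partial_x g (X x t) t = / partial_x X x t /\
  partial_t g (X x t) t = - (partial_t X x t / partial_x X x t).
Proof.
  intros Hg Hgr Hp Hq Hgx.
  pose proof (fibred_jacobian_neq0 x t Hp) as HJ.
  destruct (inverse_of_fibred_diffeomorphism _ _ _ Hphi) as [_ [HX _]].
  split.
  - assert (Hd : is_derive (fun y => X (g y t) t) (X x t)
                   (partial_x g (X x t) t * partial_x X x t)).
    { apply (is_derive_comp (fun z => X z t) (fun y => g y t)).
      - rewrite Hgx. exact (smooth_on_is_derive_x _ _ _ _ HX Hp).
      - exact (smooth_on_is_derive_x _ _ _ _ Hg Hq). }
    assert (H1 : is_derive (fun y => X (g y t) t) (X x t) 1).
    { apply (is_derive_ext_loc (fun y => y)).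
      - generalize (open_slice_x _ _ _ openD' Hq). apply filter_imp.
        intros y Hy. symmetry. apply (Hgr y t Hy).
      - apply (is_derive_id (K := R_AbsRing)). }
    apply is_derive_unique in Hd. apply is_derive_unique in H1.
    rewrite Hd in H1. apply (Rmult_eq_reg_r (partial_x X x t)); auto.
    rewrite H1. now field.
  - assert (Hd : is_derive (fun s => X (g (X x t) s) s) t
                   (partial_x X x t * partial_t g (X x t) t
                    + partial_t X x t * 1)).
    { apply is_derive_Reals.
      apply (derivable_pt_lim_comp_2d X (fun s => g (X x t) s) (fun s => s)).
      - rewrite Hgx. exact (smooth_on_differentiable _ _ _ _ openD HX Hp).
      - apply is_derive_Reals.
        exact (smooth_on_is_derive_t _ _ _ _ Hg Hq).
      - apply derivable_pt_lim_id. }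
    assert (H1 : is_derive (fun s => X (g (X x t) s) s) t 0).
    { apply (is_derive_ext_loc (fun s => X x t)).
      - generalize (open_slice_t _ _ _ openD' Hq). apply filter_imp.
        intros s Hs. symmetry. apply (Hgr _ s Hs).
      - apply (is_derive_const (K := R_AbsRing) (X x t) t). }
    apply is_derive_unique in Hd. apply is_derive_unique in H1.
    rewrite Hd in H1. apply (Rmult_eq_reg_l (partial_x X x t)); auto.
    field_simplify; auto. lra.
Qed.

(** Near [(X x t, t)] the function [f'] is [f] composed with the inverse map,
    whatever its values outside [D']. *)
Lemma transported_is_derive_x (f f' : R -> R -> R) x t l :
  (forall z s, D (z, s) -> f' (X z s) s = f z s) ->
  D (x, t) -> is_derive (fun z => f z t) x l ->
  is_derive (fun y => f' y t) (X x t) (l / partial_x X x t).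
Proof.
  intros Hf Hp Hl. destruct (inverse_of_fibred_diffeomorphism _ _ _ Hphi)
    as [g [HX [Hg [Hgl Hgr]]]].
  destruct (Hgl x t Hp) as [Hq Hgx].
  destruct (fibred_inverse_derivatives g x t Hg Hgr Hp Hq Hgx) as [Ex _].
  apply (is_derive_ext_loc (fun y => f (g y t) t)).
  - generalize (open_slice_x _ _ _ openD' Hq). apply filter_imp.
    intros y Hy. destruct (Hgr y t Hy) as [Hz HXy].
    rewrite <- (Hf _ _ Hz), HXy. reflexivity.
  - replace (l / partial_x X x t) with (partial_x g (X x t) t * l)
      by (rewrite Ex; unfold Rdiv; ring).
    apply (is_derive_comp (fun z => f z t) (fun y => g y t)).
    + rewrite Hgx. exact Hl.
    + exact (smooth_on_is_derive_x _ _ _ _ Hg Hq).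
Qed.

(** Restricted to an [h] that depends on [x] alone, which is the case of [v'];
    then [f' y t = h (g y t)] and one-variable rules suffice. *)
Lemma transported_is_derive_t (h : R -> R) (f' : R -> R -> R) x t l :
  (forall z s, D (z, s) -> f' (X z s) s = h z) ->
  D (x, t) -> is_derive h x l ->
  is_derive (fun s => f' (X x t) s) t
    (- (l * (partial_t X x t / partial_x X x t))).
Proof.
  intros Hf Hp Hl. destruct (inverse_of_fibred_diffeomorphism _ _ _ Hphi)
    as [g [HX [Hg [Hgl Hgr]]]].
  destruct (Hgl x t Hp) as [Hq Hgx].
  destruct (fibred_inverse_derivatives g x t Hg Hgr Hp Hq Hgx) as [_ Et].
  apply (is_derive_ext_loc (fun s => h (g (X x t) s))).
  - generalize (open_slice_t _ _ _ openD' Hq). apply filter_imp.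
    intros s Hs. destruct (Hgr _ s Hs) as [Hz HXs].
    rewrite <- (Hf _ _ Hz), HXs. reflexivity.
  - replace (- (l * (partial_t X x t / partial_x X x t)))
      with (partial_t g (X x t) t * l) by (rewrite Et; ring).
    apply (is_derive_comp h (fun s => g (X x t) s)).
    + rewrite Hgx. exact Hl.
    + exact (smooth_on_is_derive_t _ _ _ _ Hg Hq).
Qed.

Lemma forall_image_iff (A B : R -> R -> Prop) :
  (forall x t, D (x, t) -> (A (X x t) t <-> B x t)) ->
  (forall y t, D' (y, t) -> A y t) <-> (forall x t, D (x, t) -> B x t).
Proof.
  intros H. destruct (inverse_of_fibred_diffeomorphism _ _ _ Hphi)
    as [g [_ [_ [Hgl Hgr]]]].
  split.
  - intros HA x t Hp. apply (H x t Hp), HA. apply (Hgl x t Hp).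
  - intros HB y t Hq. destruct (Hgr y t Hq) as [Hp <-].
    apply (H _ t Hp), HB, Hp.
Qed.

End Fibred_change_of_variable.

(** * Calculus of real powers and quotients *)

(** Stated with the logarithmic derivative [l / f x], so that the same power
    appears on both sides and no exponent [p - 1] has to be simplified. *)
Lemma is_derive_Rpower (f : R -> R) x l p :
  0 < f x -> is_derive f x l ->
  is_derive (fun z => Rpower (f z) p) x (p * Rpower (f x) p * (l / f x)).
Proof.
  intros Hpos Hl.
  replace (p * Rpower (f x) p * (l / f x))
    with (l * (p * Rpower (f x) (p - 1))).
  - apply (is_derive_comp (fun y => Rpower y p) f); [| exact Hl].
    apply is_derive_Reals, derivable_pt_lim_power, Hpos.
  - replace (p - 1) with (p + - (1)) by ring.
    rewrite Rpower_plus, Rpower_Ropp, Rpower_1 by exact Hpos.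
    field. lra.
Qed.

Lemma Rpower_pred y p : 0 < y -> Rpower y p = Rpower y (p + 1) / y.
Proof.
  intros Hy. rewrite Rpower_plus, Rpower_1 by exact Hy. field. lra.
Qed.

(** Product rule for [f = z * (f / z)]; it gives [v_xx = x u_x + u] for
    [u = v_x / x], in both coordinate systems. *)
Lemma Derive_from_quotient_by_id (f : R -> R) x l :
  0 < x -> is_derive (fun z => f z / z) x l -> Derive f x = x * l + f x / x.
Proof.
  intros Hx Hl. apply is_derive_unique.
  apply (is_derive_ext_loc (fun z => z * (f z / z))).
  - generalize (open_gt 0 _ Hx). apply filter_imp.
    intros z Hz. change (z * (f z / z) = f z). field.
    exact (Rgt_not_eq _ _ Hz).
  - replace (x * l + f x / x) with (1 * (f x / x) + x * l) by ring.
    apply (is_derive_mult (fun z => z) (fun z => f z / z));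
      [apply (is_derive_id (K := R_AbsRing)) | exact Hl | exact Rmult_comm].
Qed.

(** * Power laws of the point transformation *)

Definition new_x (n v : R) : R := Rpower v (n / (2 * n + 2)).

Definition new_u (n x v u : R) : R :=
  Rpower x (- (2 / (n + 2))) * Rpower v (1 / (n + 1)) * / u.

Definition new_v (n x : R) : R :=
  n * (n + 2) / (4 * (n + 1) ^ 2) * Rpower x ((2 * n + 2) / (n + 2)).

Section Power_laws.

Variable n : R.
Hypotheses (Hn2 : n <> -2) (Hn1 : n <> -1).

Lemma new_x_pos v : 0 < new_x n v.
Proof. apply exp_pos. Qed.

Lemma new_u_pos x v u : 0 < u -> 0 < new_u n x v u.
Proof.
  intros Hu. repeat apply Rmult_lt_0_compat; try apply exp_pos.
  now apply Rinv_0_lt_compat.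
Qed.

(** The exponents combine by [2 n / (2n+2) + 1 / (n+1) = 1] for [v] and
    [(2n+2) / (n+2) - 2 = - 2 / (n+2)] for [x]; the right-hand side has the
    shape of [v'_x'] with [v_x] replaced by [x u]. *)
Lemma new_x_new_u x v u :
  0 < x -> 0 < v -> 0 < u ->
  new_x n v * new_u n x v u =
  Rpower x ((2 * n + 2) / (n + 2)) * v / (x ^ 2 * new_x n v * u).
Proof.
  intros Hx Hv Hu.
  assert (Ev : new_x n v * new_x n v * Rpower v (1 / (n + 1)) = v).
  { unfold new_x. rewrite <- !Rpower_plus.
    rewrite <- (Rpower_1 v Hv) at 2. f_equal. field. lra. }
  assert (Ex : Rpower x (- (2 / (n + 2))) * x ^ 2
               = Rpower x ((2 * n + 2) / (n + 2))).
  { rewrite <- (Rpower_pow 2 x Hx), <- Rpower_plus. f_equal. simpl.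
    field. lra. }
  rewrite <- Ex. pose proof (new_x_pos v).
  replace (Rpower x (- (2 / (n + 2))) * x ^ 2 * v)
    with (Rpower x (- (2 / (n + 2))) * x ^ 2
          * (new_x n v * new_x n v * Rpower v (1 / (n + 1)))) by now rewrite Ev.
  unfold new_u. field. lra.
Qed.

Lemma Rpower_new_u x v u :
  0 < x -> 0 < v -> 0 < u ->
  Rpower (new_u n x v u) (- (n + 1)) =
  Rpower x ((2 * n + 2) / (n + 2)) * Rpower u (n + 1) / v.
Proof.
  intros Hx Hv Hu. unfold new_u.
  assert (Hiu : 0 < / u) by now apply Rinv_0_lt_compat.
  rewrite <- !Rpower_mult_distr; try apply exp_pos; auto;
    [| apply Rmult_lt_0_compat; apply exp_pos].
  rewrite !Rpower_mult.
  replace (/ u) with (Rpower u (- (1))) by now rewrite Rpower_Ropp, Rpower_1.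
  rewrite Rpower_mult.
  replace (- (2 / (n + 2)) * - (n + 1)) with ((2 * n + 2) / (n + 2))
    by (field; lra).
  replace (1 / (n + 1) * - (n + 1)) with (- (1)) by (field; lra).
  replace (- (1) * - (n + 1)) with (n + 1) by ring.
  rewrite Rpower_Ropp, (Rpower_1 v Hv). unfold Rdiv. ring.
Qed.

(** The constant in [new_v] times the exponent [(2n+2) / (n+2)] is
    [n / (2n+2)], the exponent in [new_x]: these two factors cancel in
    [v'_x']. *)
Lemma is_derive_new_v x :
  0 < x ->
  is_derive (new_v n) x
    (n / (2 * n + 2) * Rpower x ((2 * n + 2) / (n + 2)) / x).
Proof.
  intros Hx. unfold new_v.
  replace (n / (2 * n + 2) * Rpower x ((2 * n + 2) / (n + 2)) / x)
    with (n * (n + 2) / (4 * (n + 1) ^ 2) *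
          ((2 * n + 2) / (n + 2) * Rpower x ((2 * n + 2) / (n + 2)) * (1 / x)))
    by (field; repeat split; lra).
  apply (is_derive_scal (fun z => Rpower z ((2 * n + 2) / (n + 2)))).
  apply (is_derive_Rpower (fun z => z) x 1); auto.
  apply (is_derive_id (K := R_AbsRing)).
Qed.

Lemma is_derive_new_u (v u : R -> R) x vx ux :
  0 < x -> 0 < v x -> 0 < u x -> is_derive v x vx -> is_derive u x ux ->
  is_derive (fun z => new_u n z (v z) (u z)) x
    (new_u n x (v x) (u x)
     * (- (2 / ((n + 2) * x)) + vx / ((n + 1) * v x) - ux / u x)).
Proof.
  intros Hx Hv Hu Hvx Hux. unfold new_u.
  assert (H1 := is_derive_Rpower (fun z => z) x 1 (- (2 / (n + 2))) Hx
                  (is_derive_id (K := R_AbsRing) x)).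
  assert (H2 := is_derive_Rpower v x vx (1 / (n + 1)) Hv Hvx).
  assert (H3 := is_derive_inv u x ux Hux ltac:(lra)).
  evar_last.
  - exact (is_derive_mult _ _ x _ _
             (is_derive_mult _ _ x _ _ H1 H2 Rmult_comm) H3 Rmult_comm).
  - unfold plus, mult; simpl. field. repeat split; lra.
Qed.

(** The left-hand equation is the transformed evolution equation after the
    derivatives of [v'] and [u'] have been expressed in the old variables.
    Writing [a = n / (2n+2)], one has [lambda1 = a^2] and
    [lambda2 = - a / (n+1)]; hence the term [v_x / ((n+1) v)] of [u'_x' / u']
    contributes [a / (n+1)], which cancels [lambda2]. *)
Lemma flow_equation_algebra lambda1 lambda2 x v u vx vt ux :
  n <> 0 -> 0 < x -> 0 < v -> 0 < u -> vx <> 0 ->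
  lambda1 = n ^ 2 / (4 * (n + 1) ^ 2) ->
  lambda2 = - (n / (2 * (n + 1) ^ 2)) ->
  let X := new_x n v in
  let w := new_u n x v u in
  - (n / (2 * n + 2) * Rpower x ((2 * n + 2) / (n + 2)) / x * (vt / vx)) =
    lambda1 * X * Rpower w (- (n + 2))
      * (w * (- (2 / ((n + 2) * x)) + vx / ((n + 1) * v) - ux / u)
         / (n / (2 * n + 2) * X * (vx / v)))
    + lambda2 * Rpower w (- (n + 1)) <->
  vt = x * Rpower u n * ux + 2 / (n + 2) * Rpower u (n + 1).
Proof.
  intros Hn0 Hx Hv Hu Hvx -> -> X w.
  assert (Hw : 0 < w) by now apply new_u_pos.
  assert (HX : 0 < X) by apply new_x_pos.
  rewrite (Rpower_pred w (- (n + 2))), (Rpower_pred u n) by assumption.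
  replace (- (n + 2) + 1) with (- (n + 1)) by ring.
  assert (Ew : Rpower w (- (n + 1)) =
    Rpower x ((2 * n + 2) / (n + 2)) * Rpower u (n + 1) / v)
    by now apply Rpower_new_u.
  rewrite !Ew. clearbody X w. clear Ew.
  set (B := Rpower x ((2 * n + 2) / (n + 2))).
  set (U := Rpower u (n + 1)).
  assert (HB : 0 < B) by apply exp_pos.
  (* Each side is [k] times the corresponding side of the target equation. *)
  set (k := - (n / (2 * n + 2) * B / x / vx)).
  assert (Hk : k <> 0).
  { unfold k. apply Ropp_neq_0_compat. unfold Rdiv.
    repeat apply Rmult_integral_contrapositive_currified;
      try apply Rinv_neq_0_compat; lra. }
  match goal with |- ?l = ?r <-> _ = ?e =>
    replace l with (k * vt) by (unfold k; field; repeat split; lra);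
    replace r with (k * e) by (unfold k; field; repeat split; lra) end.
  split; [intros E; exact (Rmult_eq_reg_l _ _ _ E Hk) | now intros ->].
Qed.

End Power_laws.

(** * The transformed functions and their equations *)

Section Transported_solution.

Variables (n : R) (D D' : R * R -> Prop) (v v' : R -> R -> R).
Hypotheses (Hn2 : n <> -2) (Hn1 : n <> -1) (Hn0 : n <> 0).
Hypotheses (openD : open D) (openD' : open D').
Hypothesis x_pos : forall x t, D (x, t) -> 0 < x.
Hypothesis smooth_v : smooth_on D v.
Hypothesis v_pos : forall x t, D (x, t) -> 0 < v x t.
Hypothesis Hphi :
  diffeomorphism D D' (fun p => (new_x n (v (fst p) (snd p)), snd p)).
Hypothesis Hv' : forall x t, D (x, t) -> v' (new_x n (v x t)) t = new_v n x.

Let X (x t : R) : R := new_x n (v x t).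

Lemma partial_x_new_x x t :
  D (x, t) ->
  partial_x X x t = n / (2 * n + 2) * X x t * (partial_x v x t / v x t).
Proof.
  intros Hp. apply is_derive_unique.
  apply (is_derive_Rpower (fun z => v z t)); [now apply v_pos |].
  exact (smooth_on_is_derive_x _ _ _ _ smooth_v Hp).
Qed.

Lemma partial_t_new_x x t :
  D (x, t) ->
  partial_t X x t = n / (2 * n + 2) * X x t * (partial_t v x t / v x t).
Proof.
  intros Hp. apply is_derive_unique.
  apply (is_derive_Rpower (fun s => v x s)); [now apply v_pos |].
  exact (smooth_on_is_derive_t _ _ _ _ smooth_v Hp).
Qed.

(** [v_x] is a factor of the Jacobian [X_x]. *)
Lemma partial_x_v_neq0 x t : D (x, t) -> partial_x v x t <> 0.
Proof.
  intros Hp H0. apply (fibred_jacobian_neq0 D D' X openD Hphi x t Hp).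
  rewrite (partial_x_new_x x t Hp), H0. unfold Rdiv. ring.
Qed.

Lemma partial_x_transported_v x t :
  D (x, t) ->
  partial_x v' (X x t) t =
  Rpower x ((2 * n + 2) / (n + 2)) * v x t / (x * X x t * partial_x v x t).
Proof.
  intros Hp. pose proof (x_pos x t Hp) as Hx. pose proof (v_pos x t Hp).
  pose proof (partial_x_v_neq0 x t Hp). pose proof (new_x_pos n (v x t)).
  etransitivity; [apply is_derive_unique;
    exact (transported_is_derive_x D D' X openD openD' Hphi
      (fun z _ => new_v n z) v' x t _ Hv' Hp (is_derive_new_v n Hn2 Hn1 x Hx)) |].
  rewrite (partial_x_new_x x t Hp). unfold X. field. repeat split; lra.
Qed.

Lemma partial_t_transported_v x t :
  D (x, t) ->
  partial_t v' (X x t) t =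
  - (n / (2 * n + 2) * Rpower x ((2 * n + 2) / (n + 2)) / x
     * (partial_t v x t / partial_x v x t)).
Proof.
  intros Hp. pose proof (x_pos x t Hp) as Hx. pose proof (v_pos x t Hp).
  pose proof (partial_x_v_neq0 x t Hp). pose proof (new_x_pos n (v x t)).
  etransitivity; [apply is_derive_unique;
    exact (transported_is_derive_t D D' X openD openD' Hphi (new_v n) v'
      x t _ Hv' Hp (is_derive_new_v n Hn2 Hn1 x Hx)) |].
  rewrite (partial_x_new_x x t Hp), (partial_t_new_x x t Hp).
  unfold X. field. repeat split; lra.
Qed.

Lemma transported_u_is_derive_x (u u' : R -> R -> R) x t :
  (forall z s, D (z, s) -> u' (X z s) s = new_u n z (v z s) (u z s)) ->
  D (x, t) -> 0 < u x t -> ex_derive (fun z => u z t) x ->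
  is_derive (fun y => u' y t) (X x t)
    (new_u n x (v x t) (u x t)
     * (- (2 / ((n + 2) * x)) + partial_x v x t / ((n + 1) * v x t)
        - partial_x u x t / u x t)
     / (n / (2 * n + 2) * X x t * (partial_x v x t / v x t))).
Proof.
  intros Hu' Hp Hu Hux. rewrite <- (partial_x_new_x x t Hp).
  apply (transported_is_derive_x D D' X openD openD' Hphi
           (fun z s => new_u n z (v z s) (u z s)) u' x t _ Hu' Hp).
  apply (is_derive_new_u n Hn2 Hn1 (fun z => v z t) (fun z => u z t));
    eauto using Derive_correct.
  exact (smooth_on_is_derive_x _ _ _ _ smooth_v Hp).
Qed.

(** Both sides of the primed equation are the same nonzero multiple of
    [1 / v_x] and of [1 / (u x)] respectively. *)
Lemma gradient_equation_iff u x t :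
  D (x, t) -> 0 < u ->
  partial_x v' (X x t) t = X x t * new_u n x (v x t) u <->
  partial_x v x t = u * x.
Proof.
  intros Hp Hu. pose proof (x_pos x t Hp) as Hx. pose proof (v_pos x t Hp) as Hv.
  pose proof (partial_x_v_neq0 x t Hp) as Hvx.
  pose proof (new_x_pos n (v x t)) as HX.
  rewrite (partial_x_transported_v x t Hp). unfold X.
  rewrite new_x_new_u by assumption.
  assert (HB : 0 < Rpower x ((2 * n + 2) / (n + 2))) by apply exp_pos.
  set (B := Rpower _ _) in *.
  set (k := B * v x t / (x * new_x n (v x t))).
  assert (Hk : k <> 0).
  { unfold k, Rdiv. apply Rgt_not_eq. repeat apply Rmult_lt_0_compat; try lra.
    apply Rinv_0_lt_compat. now apply Rmult_lt_0_compat. }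
  replace (B * v x t / (x * new_x n (v x t) * partial_x v x t))
    with (k * / partial_x v x t) by (unfold k; field; repeat split; lra).
  replace (B * v x t / (x ^ 2 * new_x n (v x t) * u))
    with (k * / (u * x)) by (unfold k; field; repeat split; lra).
  split; [| now intros ->].
  intros E. apply Rmult_eq_reg_l in E; auto.
  rewrite <- (Rinv_inv (partial_x v x t)), E. apply Rinv_inv.
Qed.

(** The function [u] is arbitrary so that the lemma serves the system, where
    [u] is an unknown, and the scalar equation, where [u = v_x / x]. *)
Lemma flow_equation_iff (u u' : R -> R -> R) lambda1 lambda2 x t :
  lambda1 = n ^ 2 / (4 * (n + 1) ^ 2) ->
  lambda2 = - (n / (2 * (n + 1) ^ 2)) ->
  (forall z s, D (z, s) -> u' (X z s) s = new_u n z (v z s) (u z s)) ->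
  D (x, t) -> 0 < u x t -> ex_derive (fun z => u z t) x ->
  partial_t v' (X x t) t =
    lambda1 * X x t * Rpower (u' (X x t) t) (- (n + 2))
      * partial_x u' (X x t) t
    + lambda2 * Rpower (u' (X x t) t) (- (n + 1)) <->
  partial_t v x t =
    x * Rpower (u x t) n * partial_x u x t
    + 2 / (n + 2) * Rpower (u x t) (n + 1).
Proof.
  intros H1 H2 Hu' Hp Hu Hux.
  pose proof (is_derive_unique _ _ _
    (transported_u_is_derive_x u u' x t Hu' Hp Hu Hux)) as Eu'.
  rewrite (Eu' : partial_x u' (X x t) t = _).
  rewrite (partial_t_transported_v x t Hp), (Hu' x t Hp).
  apply flow_equation_algebra; auto.
  - exact (x_pos x t Hp).
  - exact (partial_x_v_neq0 x t Hp).
Qed.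

End Transported_solution.

Theorem mainTheorem13 :
  forall n mu lambda1 lambda2 : R,
    n <> -2 -> n <> -1 -> n <> 0 ->
    mu = (3 * n + 4) / (n + 2) ->
    lambda1 = n ^ 2 / (4 * (n + 1) ^ 2) ->
    lambda2 = - (n / (2 * (n + 1) ^ 2)) ->
    transforms_system
      (fun x t v => Rpower v (n / (2 * n + 2)))
      (fun x t u v => Rpower x (- (2 / (n + 2))) * Rpower v (1 / (n + 1)) * / u)
      (fun x t v => n * (n + 2) / (4 * (n + 1) ^ 2)
                    * Rpower x ((2 * n + 2) / (n + 2)))
      (fun u' v' x' t' =>
         partial_x v' x' t' = x' * u' x' t' /\
         partial_t v' x' t' =
           lambda1 * x' * Rpower (u' x' t') (- (n + 2)) * partial_x u' x' t'
           + lambda2 * Rpower (u' x' t') (- (n + 1)))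
      (fun u v x t =>
         partial_x v x t = u x t * x /\
         partial_t v x t =
           x * Rpower (u x t) n * partial_x u x t
           + (mu - 1) / (n + 1) * Rpower (u x t) (n + 1))
    /\
    transforms_equation
      (fun x t v => Rpower v (n / (2 * n + 2)))
      (fun x t v => n * (n + 2) / (4 * (n + 1) ^ 2)
                    * Rpower x ((2 * n + 2) / (n + 2)))
      (fun v' x' t' =>
         partial_t v' x' t' =
           lambda1 * Rpower (partial_x v' x' t' / x') (- (n + 2))
             * partial_x (partial_x v') x' t'
           + (lambda2 - lambda1) * Rpower (partial_x v' x' t' / x') (- (n + 1)))
      (fun v x t =>
         partial_t v x t =
           Rpower (partial_x v x t / x) n * partial_x (partial_x v) x t
           - n / (n + 2) * Rpower (partial_x v x t / x) (n + 1)).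
Proof.
  intros n mu lambda1 lambda2 Hn2 Hn1 Hn0 Hmu H1 H2. split.
  - intros D D' u v u' v' openD openD' x_pos Hu Hv Hpos Hphi Hprescribed.
    assert (v_pos : forall x t, D (x, t) -> 0 < v x t)
      by (intros; now apply Hpos).
    assert (Hu' : forall x t, D (x, t) ->
              u' (new_x n (v x t)) t = new_u n x (v x t) (u x t))
      by (intros x t Hp; apply (Hprescribed x t Hp)).
    assert (Hv' : forall x t, D (x, t) -> v' (new_x n (v x t)) t = new_v n x)
      by (intros x t Hp; apply (Hprescribed x t Hp)).
    apply (forall_image_iff D D' (fun x t => new_x n (v x t)) Hphi).
    intros x t Hp. destruct (Hpos x t Hp) as [Hupos _].
    replace ((mu - 1) / (n + 1)) with (2 / (n + 2)) by (subst mu; field; lra).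
    rewrite (Hu' x t Hp) at 1.
    rewrite (gradient_equation_iff n D D' v v' Hn2 Hn1 Hn0 openD openD' x_pos Hv
               v_pos Hphi Hv' (u x t) x t Hp Hupos).
    rewrite (flow_equation_iff n D D' v v' Hn2 Hn1 Hn0 openD openD' x_pos Hv
               v_pos Hphi Hv' u u' lambda1 lambda2 x t H1 H2 Hu' Hp Hupos).
    + reflexivity.
    + eexists. exact (smooth_on_is_derive_x _ _ _ _ Hu Hp).
  - intros D D' v v' openD openD' x_pos Hv Hpos Hphi Hv'.
    assert (v_pos : forall x t, D (x, t) -> 0 < v x t)
      by (intros; now apply Hpos).
    (* With these choices the first equation of either system is a
       definition. *)
    set (u := fun x t => partial_x v x t / x).
    set (u' := fun y s => partial_x v' y s / y).
    assert (u_pos : forall x t, D (x, t) -> 0 < u x t).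
    { intros x t Hp. apply Rdiv_lt_0_compat; [apply (Hpos x t Hp) |].
      exact (x_pos x t Hp). }
    assert (Hu' : forall x t, D (x, t) ->
              u' (new_x n (v x t)) t = new_u n x (v x t) (u x t)).
    { intros x t Hp. pose proof (new_x_pos n (v x t)).
      pose proof (x_pos x t Hp).
      unfold u'.
      rewrite (proj2 (gradient_equation_iff n D D' v v' Hn2 Hn1 Hn0 openD openD'
                        x_pos Hv v_pos Hphi Hv' (u x t) x t Hp (u_pos x t Hp))).
      - field. lra.
      - unfold u. field. lra. }
    apply (forall_image_iff D D' (fun x t => new_x n (v x t)) Hphi).
    intros x t Hp.
    pose proof (x_pos x t Hp) as Hx. pose proof (u_pos x t Hp) as Hupos.
    pose proof (new_x_pos n (v x t)) as HX.
    assert (Hex : ex_derive (fun z => u z t) x).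
    { apply (ex_derive_div (fun z => partial_x v z t) (fun z => z)); [| | lra].
      - eexists.
        exact (smooth_on_is_derive_x _ _ _ _ (smooth_on_partial_x _ _ Hv) Hp).
      - apply (ex_derive_id (K := R_AbsRing)). }
    assert (Hu'x := Derive_correct _ _ (ex_intro _ _
       (transported_u_is_derive_x n D D' v Hn2 Hn1 openD openD'
          x_pos Hv v_pos Hphi u u' x t Hu' Hp Hupos Hex))).
    pose proof (Derive_from_quotient_by_id (fun z => partial_x v z t) x _ Hx
                  (Derive_correct _ _ Hex)) as Evxx.
    pose proof (Derive_from_quotient_by_id (fun y => partial_x v' y t)
                  (new_x n (v x t)) _ HX Hu'x) as Ev'xx.
    change (partial_x (partial_x v) x t = x * partial_x u x t + u x t) in Evxx.
    change (partial_x (partial_x v') (new_x n (v x t)) t =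
            new_x n (v x t) * partial_x u' (new_x n (v x t)) t
            + u' (new_x n (v x t)) t) in Ev'xx.
    pose proof (flow_equation_iff n D D' v v' Hn2 Hn1 Hn0 openD openD' x_pos Hv
               v_pos Hphi Hv' u u' lambda1 lambda2 x t H1 H2 Hu' Hp Hupos Hex)
      as Hflow.
    rewrite Evxx, Ev'xx.
    fold (u x t) (u' (new_x n (v x t)) t).
    assert (HU' : 0 < u' (new_x n (v x t)) t)
      by (rewrite (Hu' x t Hp); now apply new_u_pos).
    (* The extra term of [v_xx] changes the coefficient of [u^(n+1)] from
       [- n / (n+2)] to [1 - n / (n+2) = 2 / (n+2)]. *)
    replace (Rpower (u x t) n * (x * partial_x u x t + u x t)
             - n / (n + 2) * Rpower (u x t) (n + 1))
      with (x * Rpower (u x t) n * partial_x u x t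
            + 2 / (n + 2) * Rpower (u x t) (n + 1)).
    2:{ rewrite (Rpower_pred _ n Hupos). field. lra. }
    rewrite <- Hflow.
    (* Likewise the extra [lambda1] from [v'_x'x'] restores [lambda2]. *)
    match goal with |- _ = ?l <-> _ = ?r => replace l with r; [reflexivity |] end.
    rewrite (Rpower_pred _ (- (n + 2)) HU').
    replace (- (n + 2) + 1) with (- (n + 1)) by ring.
    field. lra.
Qed.
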